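(* For any integers $n\ge m\ge 2$ and $r\ge 1$, \[ \chi_{r=}^*(K_m\times K_n)= \begin{cases} n-r\big\lfloor\frac{n}{m+r}\big\rfloor,&\text{if } n\equiv 2,\ldots,m-1 \pmod{m+r} \text{ and } \Big\lceil\frac{n}{\lfloor n/(m+r)\rfloor}\Big\rceil-\Big\lfloor\frac{n}{\lceil n/(m+r)\rceil}\Big\rfloor>r;\\ m\big\lceil\frac{n}{\theta+r}\big\rceil,&\text{otherwise,} \end{cases} \] where $\theta$ is the minimum positive integer such that $\big\lfloor\frac{n}{\theta+1}\big\rfloor<\big\lceil\frac{n}{\theta+r}\big\rceil$ and $m\big\lceil\frac{n}{\theta+r}\big\rceil\le \min\big\{n-r\big\lfloor\frac{n}{m+r}\big\rfloor,\ m\big\lceil\frac{n}{m+r}\big\rceil\big\}$.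
   Context: All graphs are finite, simple, undirected. For a positive integer $k$, a (proper) $k$-coloring of a graph $G$ is a map $f:V(G)\to\{1,\dots,k\}$ with $f(x)\ne f(y)$ whenever $xy\in E(G)$; its color classes are the sets $f^{-1}(i)$, $i=1,\dots,k$. For a positive integer $r$, an $r$-equitable $k$-coloring is a $k$-coloring in which any two color classes differ in size by at most $r$; $G$ is $r$-equitably $k$-colorable if it has one. The $r$-equitable chromatic threshold $\chi_{r=}^*(G)$ is the smallest integer $k$ such that $G$ is $r$-equitably $k'$-colorable for every $k'\ge k$. The Kronecker product $G\times H$ has vertex set $V(G)\times V(H)$, with $(x,y)(x',y')$ an edge iff $xx'\in E(G)$ and $yy'\in E(H)$. $K_m$ is the complete graph on $m$ vertices. *)

(* Defs.v *)
From HB Require Import structures.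
From mathcomp Require Import all_boot.

Set Implicit Arguments.
Unset Strict Implicit.
Unset Printing Implicit Defensive.

Record sgraph := SGraph {
  vertex :> finType;
  edge : rel vertex;
  edge_sym : symmetric edge;
  edge_irrefl : irreflexive edge }.

Definition complete_rel (n : nat) : rel 'I_n := fun x y => x != y.

Lemma complete_sym n : symmetric (@complete_rel n).
Proof. by move=> x y; rewrite /complete_rel eq_sym. Qed.

Lemma complete_irrefl n : irreflexive (@complete_rel n).
Proof. by move=> x; rewrite /complete_rel eqxx. Qed.

Definition complete_graph (n : nat) : sgraph :=
  SGraph (@complete_sym n) (@complete_irrefl n).

Definition kronecker_rel (G H : sgraph) : rel (G * H) :=
  fun u v => edge u.1 v.1 && edge u.2 v.2.

Lemma kronecker_sym G H : symmetric (@kronecker_rel G H).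
Proof.
by move=> u v; rewrite /kronecker_rel (edge_sym u.1) (edge_sym u.2).
Qed.

Lemma kronecker_irrefl G H : irreflexive (@kronecker_rel G H).
Proof. by move=> u; rewrite /kronecker_rel edge_irrefl. Qed.

Definition kronecker_product (G H : sgraph) : sgraph :=
  SGraph (@kronecker_sym G H) (@kronecker_irrefl G H).

Definition proper_coloring (G : sgraph) (k : nat) (f : G -> 'I_k) : Prop :=
  forall x y : G, edge x y -> f x <> f y.

Definition color_class (G : sgraph) (k : nat) (f : G -> 'I_k) (i : 'I_k) :
  {set G} := [set x | f x == i].

(* Colors are 'I_k rather than {1, ..., k}; color classes may be empty, and
   empty classes count in the size comparison. *)
Definition equitable_coloring (r : nat) (G : sgraph) (k : nat)
    (f : G -> 'I_k) : Prop :=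
  proper_coloring f /\
  forall i j : 'I_k, #|color_class f i| <= #|color_class f j| + r.

Definition equitably_colorable (r : nat) (G : sgraph) (k : nat) : Prop :=
  exists f : G -> 'I_k, equitable_coloring r f.

Definition colorable_from (r : nat) (G : sgraph) (k : nat) : Prop :=
  0 < k /\ forall k', k <= k' -> equitably_colorable r G k'.

(* k is the r-equitable chromatic threshold of G. *)
Definition is_equitable_threshold (r : nat) (G : sgraph) (k : nat) : Prop :=
  colorable_from r G k /\ forall j, colorable_from r G j -> k <= j.

(* The ceiling of a / b, for b > 0. *)
Definition ceildiv (a b : nat) : nat := (a + b.-1) %/ b.

(* When n %/ (m + r) = 0 and m <= n, the residue n %% (m + r) = n is at least
   m, so the division by zero in the last conjunct is never consulted. *)
Definition first_case (m n r : nat) : bool :=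
  [&& 2 <= n %% (m + r), n %% (m + r) <= m - 1
    & r < ceildiv n (n %/ (m + r)) - n %/ ceildiv n (m + r)].

Definition theta_cond (m n r t : nat) : bool :=
  [&& 0 < t, n %/ (t + 1) < ceildiv n (t + r)
    & m * ceildiv n (t + r)
      <= minn (n - r * (n %/ (m + r))) (m * ceildiv n (m + r))].

Definition is_theta (m n r theta : nat) : Prop :=
  theta_cond m n r theta /\ forall t, theta_cond m n r t -> theta <= t.

(* Main.v *)
Require Import Defs.
From mathcomp Require Import all_boot zify.

(* A color class of K_m x K_n lies in a row (n cells) or a column (m cells) of
   the m x n grid.  If the smallest class has t > m cells, all classes lie in
   rows and such colorings exist exactly for k in the interval
   [m ceil(n / (t + r)), m floor(n / t)].  If t <= m, no class exceeds m + r
   cells, and counting the columns meeting a genuine column class gives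
   k >= min (n - r floor(n / (m + r)), m ceil(n / (m + r))).  Conversely every
   k >= n - r floor(n / (m + r)) is realised: for k <= n by full columns plus
   rows cut into pieces of m to m + r cells, and for k > n by a single piece in
   each column plus pieces of rows.  Below that bound, theta marks the first gap
   between the intervals of consecutive t, and the first case of the theorem is
   the one in which no interval reaches up to n - r floor(n / (m + r)). *)

Set Implicit Arguments.
Unset Strict Implicit.
Unset Printing Implicit Defensive.

(** * Ceiling division, counting in lists, distribution of a total *)

Lemma ceildiv_leq a b c : 0 < b -> (ceildiv a b <= c) = (a <= c * b).
Proof.
move=> b0; rewrite /ceildiv -ltnS ltn_divLR // mulSn; case: b b0 => // b _ /=.
by rewrite addSn ltnS addnC leq_add2l.
Qed.

Lemma leq_ceildivM a b : 0 < b -> a <= ceildiv a b * b.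
Proof. by move=> b0; rewrite -ceildiv_leq. Qed.

Lemma ceildivE a b : 0 < b -> ceildiv a b = a %/ b + (0 < a %% b).
Proof.
move=> b0; apply/eqP; rewrite eqn_leq ceildiv_leq //; apply/andP; split.
  rewrite mulnDl {1}(divn_eq a b) leq_add2l.
  by case: posnP => [->|_] //; rewrite mul1n ltnW // ltn_pmod.
have ab := leq_ceildivM a b0; rewrite {1}(divn_eq a b) in ab.
case: posnP => rho0; first by rewrite addn0 -(leq_pmul2r b0); lia.
by rewrite addn1 -(ltn_pmul2r b0); lia.
Qed.

Lemma ceildiv_anti a b c : 0 < b -> b <= c -> ceildiv a c <= ceildiv a b.
Proof.
move=> b0 bc; rewrite ceildiv_leq; last exact: leq_trans bc.
apply: leq_trans (leq_ceildivM a b0) _.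
by rewrite leq_mul2l bc orbT.
Qed.

Lemma count0_nth (T : Type) (a : pred T) (x0 : T) (s : seq T) i :
  count a s = 0 -> i < size s -> a (nth x0 s i) = false.
Proof.
by elim: s i => [|x s IHs] [|i] //=; case: (a x) => //= c0 ilt; apply: IHs.
Qed.

Lemma count1_nth (T : Type) (a : pred T) (x0 : T) (s : seq T) i :
  count a s = 1 -> i < size s -> a (nth x0 s i) = (find a s == i).
Proof.
elim: s i => [|x s IHs] [|i] //=; case: (a x) => //=.
- by rewrite add1n ltnS => -[c0] ilt; apply: count0_nth.
- by rewrite add0n eqSS ltnS; apply: IHs.
Qed.

Lemma subset_card (T : finType) (S : {set T}) a :
  a <= #|S| -> exists2 A : {set T}, A \subset S & #|A| = a.
Proof.
move=> aS; exists [set x in take a (enum S)].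
  by apply/subsetP=> x; rewrite inE => /mem_take; rewrite mem_enum.
rewrite cardsE; have /card_uniqP -> : uniq (take a (enum S)).
  by rewrite take_uniq // enum_uniq.
by rewrite size_takel // -cardE.
Qed.

(** Shares a total among rows within bounds: the first entry is taken as small as the upper bounds
    of the remaining entries allow. *)
Lemma sum_between k (lo hi : 'I_k -> nat) N :
  (forall i, lo i <= hi i) -> \sum_i lo i <= N <= \sum_i hi i ->
  exists2 c : 'I_k -> nat, forall i, lo i <= c i <= hi i & \sum_i c i = N.
Proof.
elim: k lo hi N => [|k IHk] lo hi N lohi.
  rewrite !big_ord0 => N0; exists (fun=> 0) => [[]//|]; rewrite big_ord0; lia.
rewrite !big_ord_recl; set sl := \sum_(i < k) lo _; set sh := \sum_(i < k) hi _.
move=> NB; have lh : sl <= sh by apply: leq_sum => i _; apply: lohi.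
have lh0 := lohi ord0; pose x := maxn (lo ord0) (N - sh).
have [||c cB cN] := IHk (lo \o lift ord0) (hi \o lift ord0) (N - x).
- by move=> i; apply: lohi.
- by rewrite -[\sum_i _]/sl -[\sum_i (hi \o _) i]/sh /x; lia.
exists (fun i => oapp c x (unlift ord0 i)).
  by move=> i; case: unliftP => [j ->|->] /=; [apply: cB | rewrite /x; lia].
rewrite big_ord_recl unlift_none /=.
by under eq_bigr do rewrite liftK /=; rewrite cN /x; lia.
Qed.

(** * Packings by independent sets of bounded size *)

Definition independent (G : sgraph) (A : {set G}) : bool :=
  [forall u in A, forall v in A, ~~ edge u v].

(** A list rather than a set of classes, so that empty classes may repeat and still count towards
    [k]; the last clause says that the classes partition [S]. *)
Definition packing (G : sgraph) (lo hi : nat) (S : {set G}) (k : nat) : Prop :=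
  exists P : seq {set G},
    [/\ size P = k,
        all [pred A : {set G} | independent A && (lo <= #|A| <= hi)] P
      & forall v, count (fun A : {set G} => v \in A) P = (v \in S)].

Section Packing.
Variables (G : sgraph) (lo hi : nat).
Implicit Types (A S : {set G}).

Lemma independentS A S : A \subset S -> independent S -> independent A.
Proof.
move=> /subsetP AS /'forall_in_'forall_in_idP iS.
by apply/'forall_in_'forall_in_idP => u /AS uS v /AS; apply: iS.
Qed.

Lemma packing0 : packing lo hi (set0 : {set G}) 0.
Proof. by exists [::]; split=> // v; rewrite inE. Qed.

Lemma packingU S1 S2 k1 k2 : [disjoint S1 & S2] ->
  packing lo hi S1 k1 -> packing lo hi S2 k2 ->
  packing lo hi (S1 :|: S2) (k1 + k2).
Proof.
move=> dS [P1 [<- P1B c1]] [P2 [<- P2B c2]]; exists (P1 ++ P2); split.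
- by rewrite size_cat.
- by rewrite all_cat P1B.
- move=> v; rewrite count_cat c1 c2 inE.
  by have := disjointFr dS (x := v); case: (v \in S1) => [->|].
Qed.

Lemma packing_bigcup (I : finType) (S : I -> {set G}) (k : I -> nat) :
  (forall i j v, v \in S i -> v \in S j -> i = j) ->
  (forall i, packing lo hi (S i) (k i)) ->
  packing lo hi (\bigcup_i S i) (\sum_i k i).
Proof.
move=> dS pS; rewrite -!big_enum.
have := enum_uniq I; elim: (enum I) => [|i s IHs] /=.
  by rewrite !big_nil => _; apply: packing0.
case/andP=> ns us; rewrite !big_cons; apply: packingU => //; last exact: IHs.
rewrite -setI_eq0; apply/eqP/setP=> v; rewrite !inE; apply/negP => /andP [vi].
rewrite big_tnth => /bigcupP [j _ /(dS _ _ _ vi) E]; move: ns.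
by rewrite E mem_tnth.
Qed.

Lemma packing_independent S k : independent S -> lo <= hi ->
  lo * k <= #|S| <= hi * k -> packing lo hi S k.
Proof.
move=> + lohi; elim: k S => [|k IHk] S iS SB.
  have -> : S = set0 by apply/eqP; rewrite -cards_eq0; lia.
  exact: packing0.
have lhk : lo * k <= hi * k by rewrite leq_mul2r lohi orbT.
(* The least size of a first class that leaves at most [hi * k] vertices for the other [k]
   classes. *)
have aS : maxn lo (#|S| - hi * k) <= #|S| by lia.
have [A AS cA] := subset_card aS.
have cD : #|S :\: A| = #|S| - #|A| by rewrite cardsD (setIidPr AS).
have -> : S = A :|: (S :\: A) by rewrite -{1}(setID S A) (setIidPr AS).
rewrite -[k.+1]add1n; apply: packingU.
- by rewrite -setI_eq0 setIDA setIC -setIDA setDv setI0.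
- exists [:: A]; split=> //= [|v]; last by rewrite addn0.
  by rewrite (independentS AS iS) cA; lia.
- by apply: IHk; [apply: independentS iS; apply: subsetDl | lia].
Qed.

End Packing.

Lemma packing_colorable r (G : sgraph) lo k :
  packing lo (lo + r) [set: G] k -> equitably_colorable r G k.
Proof.
move=> [P [sP /(all_nthP set0) PB cP]].
have c1 v : count (fun A : {set G} => v \in A) P = 1 by rewrite cP inE.
have fP v : find (fun A : {set G} => v \in A) P < k.
  by rewrite -sP -has_find has_count c1.
pose f v := Ordinal (fP v).
have fE v (i : 'I_k) : (f v == i) = (v \in nth set0 P i).
  by rewrite (count1_nth set0 (c1 v)) ?sP.
exists f; split=> [x y xy fxy|i j].
  have /PB /andP [/'forall_in_'forall_in_idP iA _] : f y < size P by rewrite sP.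
  have := iA x _ y; rewrite -!fE fxy eqxx => /(_ isT isT).
  by rewrite xy.
have cc (l : 'I_k) : lo <= #|color_class f l| <= lo + r.
  have -> : color_class f l = nth set0 P l by apply/setP=> v; rewrite inE fE.
  by have /PB /andP[] : l < size P by rewrite sP.
have := cc i; have := cc j; lia.
Qed.

(** * Grid colorings from rows and full columns *)

Notation grid m n := (kronecker_product (complete_graph m) (complete_graph n)).

(** Cells of [R] are colored along rows and all others along columns, with [w i] classes in row [i]
    and [z j] in column [j]. Lines of the grid are independent, so only the numbers of cells have to
    fit. *)
Lemma packing_grid m n lo hi (R : {set 'I_m * 'I_n}) (w : 'I_m -> nat)
    (z : 'I_n -> nat) : lo <= hi ->
  (forall i, lo * w i <= #|[set j | (i, j) \in R]| <= hi * w i) ->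
  (forall j, lo * z j <= #|[set i | (i, j) \notin R]| <= hi * z j) ->
  packing lo hi [set: grid m n] (\sum_i w i + \sum_j z j).
Proof.
move=> lohi wB zB.
pose S i : {set grid m n} := [set (i, j) | j in [set j | (i, j) \in R]].
pose T j : {set grid m n} := [set (i, j) | i in [set i | (i, j) \notin R]].
have SP i v : (v \in S i) = (v.1 == i) && (v \in R).
  case: v => a b; apply/imsetP/andP => [[c]|[/= /eqP -> abR]]; last first.
    by exists b; rewrite ?inE.
  by rewrite inE => icR [-> ->].
have TP j v : (v \in T j) = (v.2 == j) && (v \notin R).
  case: v => a b; apply/imsetP/andP => [[c]|[/= /eqP -> abR]]; last first.
    by exists a; rewrite ?inE.
  by rewrite inE => icR [-> ->].
have -> : [set: grid m n] = \bigcup_i S i :|: \bigcup_j T j.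
  apply/setP=> v; rewrite !inE; apply/esym/orP.
  case vR: (v \in R); [left|right]; apply/bigcupP.
    by exists v.1; rewrite // SP eqxx.
  by exists v.2; rewrite // TP eqxx vR.
apply: packingU.
- rewrite -setI_eq0; apply/eqP/setP=> v; rewrite !inE; apply/negP => /andP [].
  move=> /bigcupP [i _]; rewrite SP => /andP [_ vR] /bigcupP [j _].
  by rewrite TP vR andbF.
- apply: packing_bigcup => [i j v|i].
    by rewrite !SP => /andP [/eqP <- _] /andP [/eqP <- _].
  apply: packing_independent => //; last by rewrite card_imset // => a b [].
  apply/'forall_in_'forall_in_idP => u; rewrite SP => /andP [/eqP ui _] v.
  rewrite SP => /andP [/eqP vi _].
  by rewrite /edge /= /kronecker_rel /= /complete_rel ui vi eqxx.
- apply: packing_bigcup => [i j v|j].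
    by rewrite !TP => /andP [/eqP <- _] /andP [/eqP <- _].
  apply: packing_independent => //; last by rewrite card_imset // => a b [].
  apply/'forall_in_'forall_in_idP => u; rewrite TP => /andP [/eqP ui _] v.
  rewrite TP => /andP [/eqP vi _].
  by rewrite /edge /= /kronecker_rel /= /complete_rel ui vi eqxx andbF.
Qed.

(** A row splits into any number of pieces from [ceildiv n (t + r)] to [n %/ t], and [k] is shared
    among the rows. *)
Lemma colorable_rows m n r t k : 0 < t ->
  m * ceildiv n (t + r) <= k <= m * (n %/ t) ->
  equitably_colorable r (grid m n) k.
Proof.
move=> t0 kB; apply: (@packing_colorable _ _ t).
have [||w wB <-] := @sum_between m (fun=> ceildiv n (t + r)) (fun=> n %/ t) k.
- move=> i; have : 0 < m by case: m i {kB} => // -[].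
  by move=> m0; rewrite -(leq_pmul2l m0); lia.
- by rewrite !sum_nat_const card_ord.
have -> : \sum_i w i = \sum_i w i + \sum_(j < n) 0.
  by rewrite sum_nat_const muln0 addn0.
apply: (@packing_grid m n _ _ setT); first lia.
- move=> i; have := wB i; rewrite leq_divRL // ceildiv_leq; last lia.
  have -> : [set j | (i, j) \in [set: 'I_m * 'I_n]] = setT.
    by apply/setP=> j; rewrite !inE.
  rewrite cardsT card_ord; lia.
- move=> j; have -> : [set i | (i, j) \notin [set: 'I_m * 'I_n]] = set0.
    by apply/setP=> i; rewrite !inE.
  by rewrite cards0 !muln0.
Qed.

Lemma card_ord_lt n x : x <= n -> #|[set j : 'I_n | j < x]| = x.
Proof.
move=> xn; rewrite cardsE -sum1_card (eq_bigl (fun j : 'I_n => j < x)) //.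
rewrite -(big_mkord (fun j => j < x) (fun=> 1)) -big_filter /index_iota subn0.
by rewrite (filter_iota_ltn 0) // sum1_size size_iota.
Qed.

(** The first [x] columns are classes of [m] cells; the rest of each row is cut into [p] pieces of
    [m] to [m + r] cells. *)
Lemma colorable_columns_rows m n r p x :
  x <= n -> m * p <= n - x <= (m + r) * p ->
  equitably_colorable r (grid m n) (x + m * p).
Proof.
move=> xn pB; apply: (@packing_colorable _ _ m).
have -> : x + m * p = \sum_(i < m) p + \sum_(j < n) (j < x).
  rewrite sum_nat_const card_ord addnC; congr (_ + _).
  rewrite -[LHS](card_ord_lt xn) -sum1dep_card big_mkcond /=.
  by apply: eq_bigr => j _; case: (j < x).
pose R : {set 'I_m * 'I_n} := [set v : 'I_m * 'I_n | x <= v.2].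
apply: (@packing_grid m n _ _ R); first lia.
- move=> i; rewrite (_ : [set j | _] = ~: [set j : 'I_n | j < x]); last first.
    by apply/setP=> j; rewrite !inE -leqNgt.
  by rewrite cardsCs setCK card_ord card_ord_lt.
- move=> j; rewrite (_ : [set i | _] = [set i : 'I_m | j < x]); last first.
    by apply/setP=> i; rewrite !inE -ltnNge.
  case: (j < x) => /=.
    rewrite (_ : [set i | _] = setT) ?cardsT ?card_ord; first lia.
    by apply/setP=> i; rewrite !inE.
  by rewrite (_ : [set i | _] = set0) ?cards0; [lia | apply/setP=> i; rewrite !inE].
Qed.

(** * Colorings with at least n classes *)

(** A case of Hermite's identity: raising [N] by one shifts the summands cyclically, and the one
    that wraps around gains 1. *)
Lemma sum_divn_shift n N : 0 < n -> \sum_(j < n) (N + j) %/ n = N.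
Proof.
move=> n0; elim: N => [|N IHN].
  by apply: big1 => j _; rewrite add0n divn_small.
rewrite -[in RHS]IHN; case: n n0 {IHN} => // n _ in IHN *.
rewrite big_ord_recr [in RHS]big_ord_recl /= addn0 addSnnS.
rewrite divnDr // divnn /=.
under eq_bigr do rewrite addSnnS.
by rewrite /bump /= addnA addn1 -addnS addnC.
Qed.

(* Row i occupies the cells with numbers C i <= t < C i.+1 of a cyclic
   numbering of the columns; (N + j) %/ n counts how often column j is hit by
   the numbers below N. *)
Lemma balanced_matrix m n (c : 'I_m -> nat) : 0 < n -> (forall i, c i <= n) ->
  exists R : {set 'I_m * 'I_n},
    (forall i, #|[set j | (i, j) \in R]| = c i) /\
    (forall j : 'I_n, #|[set i | (i, j) \in R]| = (\sum_i c i + j) %/ n).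
Proof.
move=> n0 cn; pose C a := \sum_(i < m | i < a) c i.
have CS (i : 'I_m) : C i.+1 = C i + c i.
  rewrite /C (bigD1 i) //= addnC; congr (_ + _); apply: eq_bigl => j.
  by rewrite ltnS -val_eqE /= [RHS]ltn_neqAle andbC.
pose F (j : 'I_n) a := (C a + j) %/ n.
(* As [c i <= n], row [i] hits each column at most once. *)
have F01 (i : 'I_m) j : F j i <= F j i.+1 <= (F j i).+1.
  rewrite /F CS leq_div2r; last by rewrite leq_add2r leq_addr.
  have -> : ((C i + j) %/ n).+1 = (C i + j + n) %/ n.
    by rewrite [RHS]divnDr // divnn n0 addn1.
  by apply: leq_div2r; have := cn i; lia.
exists [set v : 'I_m * 'I_n | F v.2 v.1 < F v.2 v.1.+1]; split=> [i|j].
  rewrite -sum1dep_card big_mkcond /=.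
  apply/eqP; rewrite -(eqn_add2l (\sum_j F j i)) -big_split /=.
  rewrite (eq_bigr (fun j => F j i.+1)) ?sum_divn_shift ?CS // => j _.
  by have := F01 i j; rewrite inE /=; case: ifP; lia.
have -> : \sum_i c i = C m by apply: eq_bigl => i; rewrite ltn_ord.
rewrite -sum1dep_card big_mkcond /= -/(F j m).
have F0 : F j 0 = 0 by rewrite /F /C big_pred0 // add0n divn_small.
rewrite -[RHS]subn0 -[X in _ = _ - X]F0 -telescope_sumn_in //; last first.
  by move=> i im; have := F01 (Ordinal im) j; case/andP.
rewrite big_mkord; apply: eq_bigr => i _.
by have := F01 i j; rewrite !inE /=; case: ifP; lia.
Qed.

Lemma colorable_many r (G : sgraph) k :
  0 < r -> #|G| <= k -> equitably_colorable r G k.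
Proof.
move=> r0 Gk; pose f (v : G) := widen_ord Gk (enum_rank v).
have fI : injective f by move=> x y /(congr1 val) /= /val_inj /enum_rank_inj.
exists f; split=> [x y xy /fI exy|i j]; first by rewrite exy edge_irrefl in xy.
suff: #|color_class f i| <= 1 by lia.
apply/card_le1P=> x; rewrite inE => /eqP <- y.
by rewrite !inE (inj_eq fI).
Qed.

(* Every column gets one class of s or s + 1 cells, where s = m n / k; the
   other W = k - n classes lie in rows. *)
Lemma colorable_balanced m n r k : 0 < r -> m <= n -> n < k -> k <= m * n ->
  equitably_colorable r (grid m n) k.
Proof.
move=> r0 mn nk kmn.
have k0 : 0 < k by apply: leq_ltn_trans nk.
have [s [s0 sk ks]] : exists s, [/\ 0 < s, s * k <= m * n & m * n < s.+1 * k].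
  by exists (m * n %/ k); rewrite divn_gt0 // leq_divM -ltn_divLR.
have m0 : 0 < m by case: m kmn {sk ks mn} => //; rewrite leqNgt k0.
have sm : s < m.
  rewrite -(ltn_pmul2r k0); apply: leq_ltn_trans sk _.
  by rewrite ltn_pmul2l.
have n0 : 0 < n by apply: leq_trans mn.
have [W kE] : exists W, k = n + W by exists (k - n); rewrite subnKC // ltnW.
rewrite {k}kE in sk ks nk kmn k0 *.
(* [L] is the number of cells in row classes: on average these get between [s] and [s.+1] cells, and
   each column keeps between [s] and [s.+1]. The larger lower bound meets both upper bounds because
   [s * k <= m * n < s.+1 * k]. *)
have [L [L1 L2 L3 L4 L5]] : exists L, [/\ W * s <= L, n * (m - s.+1) <= L,
    L <= n * (m - s), L <= W * s.+1 & L = W * s \/ L = n * (m - s.+1)].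
  exists (maxn (W * s) (n * (m - s.+1))); rewrite leq_maxl leq_maxr !geq_max.
  rewrite !mulnBr; split=> //; last by case: leqP; [right|left].
    by clear -sk; apply/andP; split; lia.
  by clear -ks; apply/andP; split; lia.
(* The rows have room for [W] pieces of [s] cells; [m <= n] bounds the loss by rounding. *)
have Wn : W <= m * (n %/ s).
  have dm : n %% s * m <= s * n by rewrite leq_mul // ltnW // ltn_pmod.
  have nE := divn_eq n s; move: (n %/ s) (n %% s) dm nE => c d dm nE.
  by rewrite -(leq_pmul2r s0); clear -sk nE dm; nia.
(* The row classes are spread evenly, so that [w i] is [W / m] rounded down or up. *)
have [||w wB wW] := @sum_between m (fun=> W %/ m) (fun=> ceildiv W m) W.
- by move=> _; rewrite -[ceildiv _ _]/((_ + _) %/ _) leq_div2r // leq_addr.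
- rewrite !sum_nat_const card_ord mulnC leq_divM /= mulnC.
  by rewrite -ceildiv_leq.
have ws i : w i * s <= n.
  rewrite -leq_divRL //; have /andP [_ wi] := wB i; apply: leq_trans wi _.
  by rewrite ceildiv_leq // mulnC.
have lohi i : w i * s <= minn n (w i * s.+1).
  by rewrite leq_min ws leq_mul2l leqnSn orbT.
have [//||c cB cL] := @sum_between m (fun i => w i * s)
    (fun i => minn n (w i * s.+1)) L.
- rewrite -big_distrl /= wW L1 /=; case: L5 => ->.
    by rewrite -{1}wW big_distrl /= leq_sum.
  case: (leqP (ceildiv W m * s.+1) n) => Hn.
    rewrite (eq_bigr (fun i => w i * s.+1)).
      by rewrite -big_distrl /= wW; apply: leq_trans L4.
    move=> i _; apply/minn_idPr; apply: leq_trans Hn.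
    by rewrite leq_mul2r; have /andP [_ ->] := wB i.
  (* Here some [w i * s.+1] may exceed [n], but each row can still supply [n - s.+1] cells, and
     [m * (n - s.+1)] is at least [L = n * (m - s.+1)] since [m <= n]. *)
  have Hw : n - s.+1 <= W %/ m * s.+1.
    rewrite leq_subLR -mulSn; apply: leq_trans (ltnW Hn) _.
    by rewrite leq_mul2r ceildiv_leq // ltnW // ltn_ceil.
  apply: (@leq_trans (\sum_(i < m) (n - s.+1))).
    by rewrite sum_nat_const card_ord !mulnBr [n * m]mulnC leq_sub2l // leq_mul.
  apply: leq_sum => i _; rewrite leq_min leq_subr /=; apply: leq_trans Hw _.
  by rewrite leq_mul2r; have /andP [->] := wB i.
have [//||R [Rr Rc]] := @balanced_matrix m n c.
  by move=> i; have := cB i; rewrite leq_min => /and3P [].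
apply: (@packing_colorable _ _ s).
have -> : n + W = \sum_i w i + \sum_(j < n) 1.
  by rewrite wW sum_nat_const card_ord muln1 addnC.
apply: (@packing_grid m n _ _ R); first exact: leq_addr.
- move=> i; rewrite Rr; have := cB i; rewrite leq_min => /and3P [c1 _ c2].
  rewrite mulnC c1 /= mulnC; apply: leq_trans c2 _.
  by rewrite leq_mul2l -addn1 leq_add2l r0 orbT.
(* The bounds on [L] force [(L + j) %/ n] to be [m - s.+1] or [m - s], so column [j] keeps [s] or
   [s.+1] cells. *)
- move=> j; have -> : [set i | (i, j) \notin R] = ~: [set i | (i, j) \in R].
    by apply/setP=> i; rewrite !inE.
  rewrite cardsCs setCK card_ord Rc cL.
  have : m - s.+1 <= (L + j) %/ n.
    by rewrite leq_divRL // mulnC (leq_trans L2) // leq_addr.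
  have : (L + j) %/ n < (m - s).+1.
    by rewrite ltn_divLR // mulSn addnC [_ * n]mulnC -addSn leq_add.
  by move: (_ %/ _) => x; clear -sm r0; lia.
Qed.

Lemma colorable_ge m n r k : 0 < m -> 0 < r -> m <= n -> n <= k ->
  equitably_colorable r (grid m n) k.
Proof.
move=> m0 r0 mn; rewrite leq_eqVlt => /predU1P [<-|nk].
  rewrite -[X in equitably_colorable _ _ X]addn0 -(muln0 m).
  by apply: colorable_columns_rows => //; lia.
case: (leqP k (m * n)) => kmn; first exact: colorable_balanced.
by apply: colorable_many => //; rewrite card_prod !card_ord ltnW.
Qed.

(** * Class counts of a given grid coloring *)

Lemma sum_card_disjoint (I T : finType) (D : I -> {set T}) :
  (forall i j x, x \in D i -> x \in D j -> i = j) ->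
  \sum_i #|D i| = #|\bigcup_i D i|.
Proof.
move=> dD; rewrite -sum1_card [RHS]big_mkcond /=.
rewrite (eq_bigr (fun i => \sum_x (x \in D i))) => [|i _]; last first.
  by rewrite -sum1_card big_mkcond; apply: eq_bigr => x _; case: (x \in D i).
rewrite exchange_big /=; apply: eq_bigr => x _;
case: ifP => [/bigcupP [i _ xi]|].
  rewrite (bigD1 i) //= xi big1 // => j ji; case xj: (x \in D j) => //.
  by rewrite (dD _ _ _ xj xi) eqxx in ji.
move=> /negP nx; apply: big1 => i _; case xi: (x \in D i) => //.
by case: nx; apply/bigcupP; exists i.
Qed.

Lemma card_imset_fibers (T U : finType) (g : T -> U) (S : {set T}) lo hi :
  (forall x, x \in S -> lo <= #|[set y in S | g y == g x]| <= hi) ->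
  lo * #|g @: S| <= #|S| <= hi * #|g @: S|.
Proof.
move=> gB; rewrite -(sum1_card (mem S)) (partition_big_imset g) /=.
rewrite ![_ * #|_|]mulnC -!sum_nat_const; apply/andP; split; apply: leq_sum.
  move=> _ /imsetP [x xS ->]; have /andP [+ _] := gB x xS.
  by rewrite -sum1dep_card.
move=> _ /imsetP [x xS ->]; have /andP [_ +] := gB x xS.
by rewrite -sum1dep_card.
Qed.

Section GridColoring.
Variables (m n k : nat) (f : grid m n -> 'I_k).
Hypothesis pf : proper_coloring f.

(** Cells of equal color share a row or a column. So [u] and [v] share their column, and a cell [w]
    in the row of [u] can meet [v] only in that column. *)
Lemma column_class (u v w : grid m n) :
  f u = f v -> u.1 != v.1 -> f w = f u -> w.2 = u.2.
Proof.
have same_line (x y : grid m n) : f x = f y -> x.1 = y.1 \/ x.2 = y.2.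
  move=> fxy; case: (eqVneq x.1 y.1) => [|ne1]; first by left.
  case: (eqVneq x.2 y.2) => [|ne2]; first by right.
  by case: (@pf x y) => //;
  rewrite /edge /= /kronecker_rel /= /edge /= /complete_rel ne1.
move=> fuv uv fwu; case: (same_line _ _ fwu) => // wu1.
have [vu1|vu2] := same_line _ _ fuv; first by rewrite vu1 eqxx in uv.
have [wv1|wv2] := same_line w v (etrans fwu fuv); last by rewrite wv2.
by rewrite -wu1 wv1 eqxx in uv.
Qed.

(** A class with cells in two rows lies in one column and has at most [m] cells. So each color stays
    in one row, and the colors can be counted row by row. *)
Lemma rows_count lo hi : m < lo ->
  (forall c, lo <= #|color_class f c| <= hi) ->
  m * ceildiv n hi <= k <= m * (n %/ lo).
Proof.
move=> mlo cB.
have row u v : f u = f v -> u.1 = v.1.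
  move=> fuv; apply/eqP; apply: contraLR mlo => uv; rewrite -leqNgt.
  have /andP [lo1 _] := cB (f u); apply: leq_trans lo1 _.
  rewrite -[X in _ <= X]card_ord -cardsT.
  rewrite -(card_imset [set: 'I_m] (f := fun i => (i, u.2))); last by move=> a b [].
  apply: subset_leq_card; apply/subsetP=> w; rewrite inE => /eqP fw.
  apply/imsetP; exists w.1; rewrite ?inE //.
  by rewrite -(column_class fuv uv fw) -surjective_pairing.
pose D i := [set f (i, j) | j in [set: 'I_n]].
have DB i : lo * #|D i| <= n <= hi * #|D i|.
  have := @card_imset_fibers _ _ (fun j => f (i, j)) [set: 'I_n] lo hi.
  rewrite cardsT card_ord; apply=> j _.
  suff -> : #|[set y in [set: 'I_n] | f (i, y) == f (i, j)]|
            = #|color_class f (f (i, j))| by [].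
  rewrite -(card_imset _ (f := fun j => (i, j))); last by move=> a b [].
  congr #|pred_of_set _|; apply/setP=> w; rewrite inE.
  apply/imsetP/eqP => [[y]|fw]; first by rewrite !inE => /eqP <- ->.
  have wE : w = (i, w.2) by rewrite [LHS]surjective_pairing (row _ _ fw).
  by exists w.2; rewrite // !inE -wE fw eqxx.
have <- : \sum_i #|D i| = k.
  rewrite sum_card_disjoint => [|i i' _ /imsetP [j _ ->] /imsetP [j' _] /row //].
  rewrite -[RHS]card_ord -cardsT; congr #|pred_of_set _|.
  apply/setP=> c; rewrite inE; apply/bigcupP.
  have : 0 < #|color_class f c| by have := cB c; lia.
  case/card_gt0P=> w; rewrite inE => /eqP <-; exists w.1 => //.
  by apply/imsetP; exists w.2; rewrite -?surjective_pairing.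
have cm a : m * a = \sum_(i < m) a by rewrite sum_nat_const card_ord.
rewrite !cm.
have lo0 : 0 < lo by lia.
apply/andP; split; apply: leq_sum => i _; have := DB i.
  (* For [hi = 0] the ceiling evaluates to 0, and the bound is trivial. *)
  case: (posnP hi) => [->|hi0] DBi; last by rewrite ceildiv_leq //; lia.
  by rewrite /ceildiv divn0.
by rewrite leq_divRL //; lia.
Qed.

(** [N] holds the colors seen in two rows and [X] the columns they meet; [x] is the size of [X].
    Outside [X], rows share no colors with each other or with [N], and each needs at least
    [ceildiv (n - x) hi] of them. *)
Lemma columns_rows_count hi : 0 < hi ->
  (forall c, #|color_class f c| <= hi) ->
  exists2 x, x <= n & x + m * ceildiv (n - x) hi <= k.
Proof.
move=> hi0 cB.
pose N := [set c | [exists u, exists v, [&& f u == c, f v == c & u.1 != v.1]]].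
have NP u v : f u = f v -> u.1 != v.1 -> f u \in N.
  move=> fuv uv; rewrite inE; apply/existsP; exists u; apply/existsP; exists v.
  by rewrite fuv eqxx.
pose X := [set j : 'I_n | [exists u, (u.2 == j) && (f u \in N)]].
have NX u : f u \in N -> u.2 \in X.
  by move=> fu; rewrite inE; apply/existsP; exists u; rewrite eqxx.
have Ncol u w : f u \in N -> f w = f u -> w.2 = u.2.
  rewrite inE => /existsP [a /existsP [b /and3P [/eqP fa /eqP fb ab]]] fwu.
  have cl := column_class (etrans fa (esym fb)) ab.
  by rewrite (cl w) ?(cl u) // fa.
have XN : #|X| <= #|N|.
  (* A color of [N] occurs in one column only, so [h] maps [N] onto a set containing [X]; the option
     type covers colors without cells. *)
  pose h c := omap snd [pick v | f v == c].
  have Some_inj : injective (@Some 'I_n) by move=> a b [].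
  rewrite -(card_imset X Some_inj); apply: leq_trans (leq_imset_card h N).
  apply: subset_leq_card; apply/subsetP=> _ /imsetP [j + ->].
  rewrite inE => /existsP [u /andP [/eqP <- fu]]; apply/imsetP; exists (f u) => //.
  rewrite /h; case: pickP => [w /eqP fw|/(_ u)]; last by rewrite eqxx.
  by rewrite /= (Ncol u w).
pose D i := [set f (i, j) | j in ~: X].
have DN i c : c \in D i -> c \notin N.
  case/imsetP=> j; rewrite inE => jX ->; apply: contra jX; exact: NX.
have DD i i' c : c \in D i -> c \in D i' -> i = i'.
  move=> cD; have := DN _ _ cD; case/imsetP: cD => j _ -> fN /imsetP [j' _ E].
  by apply/eqP; apply: contraNT fN => ii; apply: NP E _.
exists #|X|; first by rewrite -[X in _ <= X]card_ord; apply: max_card.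
have NDk : #|N| + \sum_i #|D i| <= k.
  rewrite sum_card_disjoint // -[X in _ <= X]card_ord -cardsUI.
  rewrite (_ : N :&: _ = set0) ?cards0 ?addn0 ?max_card //.
  apply/setP=> c; rewrite in_setI in_set0; apply/negP => /andP [cN /bigcupP [i _ /DN]].
  by rewrite cN.
apply: leq_trans NDk; apply: leq_add => //.
rewrite -[X in X * _]card_ord -sum_nat_const; apply: leq_sum => i _.
rewrite ceildiv_leq // mulnC.
have -> : n - #|X| = #|~: X| by rewrite [RHS]cardsCs setCK card_ord.
have /andP [_ //] : 0 * #|D i| <= #|~: X| <= hi * #|D i|.
apply: card_imset_fibers => j jX /=; apply: leq_trans (cB (f (i, j))).
rewrite -[X in X <= _](card_imset _ (f := fun j => (i, j))); last by move=> a b [].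
apply: subset_leq_card; apply/subsetP=> _ /imsetP [y + ->].
by rewrite !inE => /andP [].
Qed.

End GridColoring.

Lemma colorable_bounds m n r k : 0 < m -> 0 < n ->
  equitably_colorable r (grid m n) k ->
  (exists2 t, m < t & m * ceildiv n (t + r) <= k <= m * (n %/ t)) \/
  (exists2 x, x <= n & x + m * ceildiv (n - x) (m + r) <= k).
Proof.
move=> m0 n0 [f [pf eqf]].
pose c0 := f (Ordinal m0, Ordinal n0).
case: (@arg_minnP _ c0 xpredT (fun c => #|color_class f c|)) => // c _ cmin.
case: (ltnP m #|color_class f c|) => mc; [left|right].
  exists #|color_class f c| => //; apply: (rows_count pf) => // d.
  by rewrite cmin // eqf.
apply: (columns_rows_count pf); first by rewrite addn_gt0 m0.
by move=> d; apply: leq_trans (eqf d c) _; rewrite leq_add2r.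
Qed.

(** * The threshold *)

Section Threshold.
Variables m n r : nat.
Hypotheses (hm : 2 <= m) (hmn : m <= n) (hr : 1 <= r).

Let q := n %/ (m + r).
Let rho := n %% (m + r).
(* kmix classes arise from q blocks of m + r columns cut into rows and from the
   remaining columns; with fewer than kmin classes, one has over m + r cells. *)
Let kmix := n - r * q.
Let kmin := minn kmix (m * ceildiv n (m + r)).

Let m0 : 0 < m. Proof. exact: ltnW. Qed.
Let n0 : 0 < n. Proof. exact: leq_trans hmn. Qed.
Let mr0 : 0 < m + r. Proof. by rewrite addn_gt0 m0. Qed.
Let nE : n = q * (m + r) + rho. Proof. exact: divn_eq. Qed.
Let rho_lt : rho < m + r. Proof. exact: ltn_pmod. Qed.
Let AE : kmix = q * m + rho.
Proof. by rewrite /kmix [X in X - _]nE mulnDr [r * q]mulnC addnAC addnK. Qed.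

Let ceil_eq : ceildiv n (m + r) = q + (0 < rho).
Proof. exact: ceildivE. Qed.

Lemma colorable_ge_mixed k : kmix <= k -> equitably_colorable r (grid m n) k.
Proof.
move=> Ak; case: (leqP n k) => kn; first exact: colorable_ge.
have mqk : m * q <= k by rewrite mulnC; apply: leq_trans Ak; rewrite AE leq_addr.
(* Take [k - m * q] full columns and [q] pieces per row; [k >= kmix] leaves at most [(m + r) * q]
   cells in each row. *)
rewrite -(subnK mqk); apply: colorable_columns_rows; first lia.
have kA : q * m + rho <= k by rewrite -AE.
have := nE; have := kn; have := mqk; have := kA.
by clear; move: q rho => q0 rho0; nia.
Qed.

(** With [p] the ceiling, [p <= q] gives [x + m * p >= n - r * p >= kmix]; otherwise [p] is at least
    [ceildiv n (m + r)]. *)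
Lemma mixed_minimal x : x <= n -> kmin <= x + m * ceildiv (n - x) (m + r).
Proof.
move=> xn; have := leqnn (ceildiv (n - x) (m + r)).
rewrite {1}ceildiv_leq //; move: (ceildiv (n - x) (m + r)) => p np.
rewrite /kmin geq_min; case: (leqP p q) => pq; apply/orP; [left|right].
  have := AE; have := nE; move: np pq xn; clear.
  by move: kmix q rho => A0 q0 rho0; nia.
apply: leq_trans (leq_addl _ _); rewrite leq_mul2l ceil_eq.
by apply/orP; right; lia.
Qed.

Lemma theta_exists : exists theta, is_theta m n r theta.
Proof.
have ex : exists t, theta_cond m n r t.
  (* At [n] the floor is 0 and the ceiling is 1, and [m] is within both bounds. *)
  exists n; rewrite /theta_cond n0 addn1 divn_small //=.
  have c1 : ceildiv n (n + r) <= 1.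
    by rewrite ceildiv_leq ?mul1n ?leq_addr // addn_gt0 n0.
  rewrite ltnNge ceildiv_leq ?addn_gt0 ?n0 // mul0n -ltnNge n0 /=.
  apply: (@leq_trans (m * 1)); first by rewrite leq_mul2l c1 orbT.
  rewrite -/q -/kmix muln1 leq_min AE ceil_eq.
  have := nE; have := hmn; have := m0; clear; move: q rho => [|q0] [|rho0] /=; nia.
by exists (ex_minn ex); case: ex_minnP => t.
Qed.

(** From [t] up to [theta] the size condition persists, so by minimality of [theta] only the gap
    condition can fail before it: the intervals of consecutive values overlap and cover everything
    in between. *)
Lemma colorable_chain theta t k : is_theta m n r theta ->
  0 < t <= theta -> m * ceildiv n (t + r) <= kmin ->
  m * ceildiv n (theta + r) <= k <= m * (n %/ t) ->
  equitably_colorable r (grid m n) k.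
Proof.
move=> [_ thmin] /andP [t0 /subnKC].
move: (theta - t) => d; elim: d t t0 k => [|d IHd].
  move=> t t0 k <- tB; rewrite addn0; exact: colorable_rows.
move=> t t0 k tE tB /andP [k1 k2].
case: (leqP k (m * (n %/ t.+1))) => kt.
  apply: (IHd t.+1) => //; first by rewrite addSnnS.
  - apply: leq_trans tB; rewrite leq_mul2l.
    by rewrite ceildiv_anti ?orbT ?addn_gt0 ?t0 // leq_add2r.
  - by rewrite k1.
apply: (@colorable_rows _ _ _ t) => //; rewrite k2 andbT.
apply: leq_trans (ltnW kt); rewrite leq_mul2l -addn1 leqNgt orbC.
apply/orP; left; apply/negP => lt; have : theta_cond m n r t by apply/and3P.
by move/thmin; rewrite -tE; lia.
Qed.

(** For [t] beyond [theta], the interval of [theta] already reaches [m * (n %/ t)]. *)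
Lemma colorable_target theta t k : is_theta m n r theta ->
  0 < t -> m * ceildiv n (t + r) <= kmin ->
  m * ceildiv n (theta + r) <= k <= m * (n %/ t) ->
  equitably_colorable r (grid m n) k.
Proof.
move=> thP t0 tB /andP [k1 k2]; case: (leqP t theta) => tth.
  by apply: (colorable_chain thP _ tB); rewrite ?t0 ?k1.
have [/and3P [th0 _ thB] _] := thP.
apply: (colorable_chain thP _ thB); rewrite ?th0 ?leqnn ?k1 //=.
by apply: leq_trans k2 _; rewrite leq_mul2l leq_div2l ?orbT // ltnW.
Qed.

Lemma colorable_ge_theta theta k : is_theta m n r theta -> ~~ first_case m n r ->
  m * ceildiv n (theta + r) <= k -> equitably_colorable r (grid m n) k.
Proof.
move=> thP nfc k1; case: (leqP kmix k) => kA; first exact: colorable_ge_mixed.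
(* It remains to find [t] whose interval starts by [kmin] and reaches [k]; [Q] bounds its ceiling
   from above and [P] its floor from below. The choice depends on [rho]. *)
have target t Q P : 0 < t -> n <= Q * (t + r) -> m * Q <= kmix ->
    Q <= q + (0 < rho) -> P * t <= n -> k <= m * P ->
    equitably_colorable r (grid m n) k.
  move=> t0 nQ QA Qq Pn kP; apply: (colorable_target thP t0).
    apply: (@leq_trans (m * Q)); last first.
      by rewrite /kmin leq_min QA leq_mul2l ceil_eq Qq orbT.
    by rewrite leq_mul2l ceildiv_leq ?addn_gt0 ?t0 // nQ orbT.
  by rewrite k1 (leq_trans kP) // leq_mul2l leq_divRL // Pn orbT.
have qE : 0 < q \/ m <= rho.
  by have := hmn; have := nE; clear; move: q rho => [|q0] rho0 nE; [right|left]; lia.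
case: (leqP m rho) => mrho.
  have rho0 : 0 < rho by apply: leq_trans mrho.
  case: (leqP (m * q.+1) k) => kq.
    rewrite -(subnK kq); apply: colorable_columns_rows.
      by have := leq_subr (r * q) n; rewrite -/kmix; lia.
    have := AE; have := nE; have := kA; have := kq; have := rho_lt; clear.
    by move: kmix q rho => A0 q0 rho0; nia.
  apply: (@target m q.+1 q.+1) => //; last exact: ltnW.
  - by have := nE; have := rho_lt; clear; move: q rho => q0 rho0; nia.
  - by rewrite AE; have := mrho; clear; nia.
  - by rewrite rho0 addn1.
  - by have := nE; have := mrho; clear; move: q rho => q0 rho0; nia.
have q0 : 0 < q by case: qE => //; rewrite leqNgt mrho.
case: (posnP rho) => rho0.
  have Am : kmix = m * q by rewrite AE rho0 addn0 mulnC.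
  apply: (@target m q q) => //; rewrite -?Am ?leq_addr // ?[k <= _]ltnW //.
    by rewrite {1}nE rho0 addn0.
  by rewrite nE rho0 addn0 mulnDr leq_addr.
case: (leqP rho 1) => rho1.
  have rhoE : rho = 1 by apply/eqP; rewrite eqn_leq rho1.
  have Am : kmix = (m * q).+1 by rewrite AE rhoE addn1 mulnC.
  (* The one extra column is absorbed by pieces of [m.+1] to [m.+1 + r] cells. *)
  apply: (@target m.+1 q q) => //.
  - by rewrite {1}nE rhoE addSn mulnS addnC leq_add2r.
  - by rewrite Am.
  - exact: leq_addr.
  - by rewrite nE rhoE mulnS mulnDr; have := hr; clear; nia.
  - by rewrite -ltnS -Am.
move: nfc; rewrite /first_case -/q -/rho rho1 ceil_eq rho0 addn1.
rewrite -ltnS subn1 prednK // mrho /= -leqNgt leq_subLR.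
set c := ceildiv n q; set p := n %/ q.+1 => cp.
have nc : n <= c * q by apply: leq_ceildivM.
have pn : p * q.+1 <= n by apply: leq_divM.
have rc : r < c.
  rewrite ltnNge; apply/negP => cr.
  have := leq_trans nc (leq_mul cr (leqnn q)); have := nE; have := m0; have := q0.
  by clear; move: q rho => a b; nia.
(* With [c <= p + r], rows can be cut into [q] pieces of at most [c] cells or [q.+1] pieces of at
   least [c - r] cells, as [c - r <= p]. *)
apply: (@target (c - r) q q.+1).
- by rewrite subn_gt0.
- by rewrite (subnK (ltnW rc)) mulnC.
- by rewrite AE mulnC leq_addr.
- exact: leq_addr.
- apply: leq_trans pn; rewrite mulnC leq_mul2r leq_subLR addnC; lia.
- by apply: ltnW; apply: leq_trans kA _; rewrite AE; have := mrho; clear; nia.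
Qed.

(** A smaller threshold would make [k.-1] colorable, but it lies in no row interval with [t > m] and
    below every count that uses classes of at most [m + r] cells. *)
Lemma threshold_lower k : 0 < k -> k <= kmin ->
  (forall t, m < t -> ~~ (m * ceildiv n (t + r) <= k.-1 <= m * (n %/ t))) ->
  forall j, colorable_from r (grid m n) j -> k <= j.
Proof.
move=> k0 kB nt j [_ jc]; rewrite leqNgt; apply/negP => jk.
have /(colorable_bounds m0 n0) : equitably_colorable r (grid m n) k.-1.
  by apply: jc; rewrite -ltnS prednK.
case=> [[t mt tk]|[x xn xk]]; first by have := nt t mt; rewrite tk.
by have := leq_trans kB (leq_trans (mixed_minimal xn) xk);
rewrite -ltnS prednK // ltnn.
Qed.

Lemma threshold_first : first_case m n r -> is_equitable_threshold r (grid m n) kmix.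
Proof.
rewrite /first_case -/q -/rho => /and3P [rho2 rhom].
have rho0 : 0 < rho by apply: leq_trans rho2.
rewrite ceil_eq rho0 addn1 => gap.
have A0 : 0 < kmix by rewrite AE addn_gt0 rho0 orbT.
split; first by split=> // k; apply: colorable_ge_mixed.
apply: threshold_lower => // [|t mt].
  by rewrite /kmin leq_min leqnn ceil_eq rho0 AE; have := rhom; clear; nia.
apply/negP => /andP [k1 k2].
have q0 : 0 < q.
  have := hmn; have := rhom; have := m0; have := nE; clear.
  by move: q rho => [|a] b //; lia.
have t0 : 0 < t by apply: leq_trans mt.
(* As [kmix.-1] lies strictly between [m * q] and [m * q.+1], an interval containing it allows both
   [q] and [q.+1] pieces per row, which contradicts [gap]. *)
have cq : ceildiv n (t + r) <= q.
  rewrite -ltnS -(ltn_pmul2l m0); apply: leq_ltn_trans k1 _.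
  by rewrite AE; have := rhom; have := rho2; have := m0; clear; nia.
have qt : q < n %/ t.
  rewrite -(ltn_pmul2l m0); apply: leq_trans k2.
  by rewrite AE; have := rho2; clear; nia.
move: gap; rewrite ltnNge leq_subLR => /negP; apply.
rewrite ceildiv_leq //; move: cq; rewrite ceildiv_leq ?addn_gt0 ?t0 //.
move=> /leq_trans; apply.
rewrite mulnC leq_mul2r leq_add2r leq_divRL // mulnC -leq_divRL // qt; lia.
Qed.

Lemma threshold_theta theta : is_theta m n r theta -> ~~ first_case m n r ->
  is_equitable_threshold r (grid m n) (m * ceildiv n (theta + r)).
Proof.
move=> thP nfc; have [/and3P [th0 gap thB] _] := thP.
have thr0 : 0 < theta + r by rewrite addn_gt0 th0.
have c0 : 0 < ceildiv n (theta + r) by rewrite ltnNge ceildiv_leq // -ltnNge.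
have k0 : 0 < m * ceildiv n (theta + r) by rewrite muln_gt0 m0.
split; first by split=> // k; apply: colorable_ge_theta.
apply: threshold_lower => // t mt; apply/negP => /andP [k1 k2].
(* Intervals with [t <= theta] start too late. Beyond [theta] they end at least [m >= 2] below the
   claimed threshold, hence before its predecessor. *)
case: (leqP t theta) => tth.
  have : ceildiv n (theta + r) <= ceildiv n (t + r).
    by apply: ceildiv_anti; rewrite ?leq_add2r // addn_gt0 (leq_ltn_trans _ mt).
  move/(leq_mul (leqnn m))/leq_trans/(_ k1).
  by rewrite -ltnS prednK // ltnn.
have nt : n %/ t <= n %/ (theta + 1) by rewrite leq_div2l ?addn1.
have : m * (n %/ t).+1 <= m * ceildiv n (theta + r).
  by rewrite leq_mul2l (leq_ltn_trans nt gap) orbT.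
by have := k2; have := k0; have := hm; rewrite mulnS; clear; lia.
Qed.

End Threshold.

Theorem theorem6 (m n r : nat) (hm : 2 <= m) (hmn : m <= n) (hr : 1 <= r) :
  exists theta : nat,
    is_theta m n r theta /\
    is_equitable_threshold r
      (kronecker_product (complete_graph m) (complete_graph n))
      (if first_case m n r then n - r * (n %/ (m + r))
       else m * ceildiv n (theta + r)).
Proof.
have [theta thP] := theta_exists r hm hmn; exists theta; split=> //.
case: ifPn => fc; first exact: threshold_first.
exact: threshold_theta.
Qed.
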